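(* Consider the system $$\sigma x=Ax+Bu+E,\qquad y=Cx+Du+F,$$ with $A\in\mathbb{R}^{n\times n}$, $B\in\mathbb{R}^{n\times m}$, $C\in\mathbb{R}^{p\times n}$, $D\in\mathbb{R}^{p\times m}$, $E\in\mathbb{R}^n$, $F\in\mathbb{R}^p$, and assume that the pair $(A,B)$ is controllable. Let $u_d\in(\mathbb{R}^m)^{\mathbf{T}}$, $x_d\in(\mathbb{R}^n)^{\mathbf{T}}$, $y_d\in(\mathbb{R}^p)^{\mathbf{T}}$ be an input/state/output trajectory of the system. Let $L\in\mathbb{N}$ and assume that $u_d$ is persistently exciting of order $n+L$ for the model class $\mathcal{A}$. Then the following hold. (i) The rank condition $$\operatorname{rank}\begin{bmatrix}H_1\big(x_d|_{[1,T-L+1]}\big)\\ H_L(u_d)\\ \mathbb{1}^{\top}\end{bmatrix}=mL+n+1$$ holds. (ii) Every (input/output) trajectory $\begin{bmatrix}u\\ y\end{bmatrix}\in\mathbb{R}^{(m+p)L}$ of the system of length $L$ can be expressed as $$\begin{bmatrix}u\\ y\end{bmatrix}=\begin{bmatrix}H_L(u_d)\\ H_L(y_d)\end{bmatrix}g$$ for some $g\in\mathbb{R}^{T-L+1}$ such that $\mathbb{1}^{\top}g=1$.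
   Context: $(\sigma x)(t)=x(t+1)$; $\mathbb{N}$ is the set of positive integers; $\mathbf{T}=\{1,\dots,T\}$. Finite sequences $u,x,y$ of length $T$ form an input/state/output trajectory of the system if $x(t+1)=Ax(t)+Bu(t)+E$ for $t=1,\dots,T-1$ and $y(t)=Cx(t)+Du(t)+F$ for $t=1,\dots,T$; an input/output trajectory of length $L$ is a pair $(u,y)$ of sequences of length $L$ for which a corresponding $x$ exists. In (ii), $u$ and $y$ are identified with $\operatorname{col}(u(1),\dots,u(L))$ and $\operatorname{col}(y(1),\dots,y(L))$. The pair $(A,B)$ is controllable if $\operatorname{rank}\begin{bmatrix}B&AB&\cdots&A^{n-1}B\end{bmatrix}=n$. For $v\in(\mathbb{R}^k)^{\mathbf{T}}$ and $L\in\mathbf{T}$, the Hankel matrix $H_L(v)\in\mathbb{R}^{kL\times(T-L+1)}$ has $j$-th column $\operatorname{col}(v(j),\dots,v(j+L-1))$, $j=1,\dots,T-L+1$; in particular $H_1(x_d|_{[1,T-L+1]})=[x_d(1)\ \cdots\ x_d(T-L+1)]$. $\mathbb{1}$ is the all-ones column vector of appropriate size. A sequence $u\in(\mathbb{R}^m)^{\mathbf{T}}$ is persistently exciting of order $K\in\mathbf{T}$ for the model class $\mathcal{A}$ (affine time-invariant systems) if $\operatorname{rank}\begin{bmatrix}H_K(u)\\ \mathbb{1}^{\top}\end{bmatrix}=mK+1$. *)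

(* Defs.v *)
From HB Require Import structures.
From mathcomp Require Import all_boot all_order all_algebra.
From mathcomp Require Import reals.

Set Implicit Arguments.
Unset Strict Implicit.
Unset Printing Implicit Defensive.

Import Order.TTheory GRing.Theory Num.Theory.
Local Open Scope ring_scope.

(* A sequence v(1), ..., v(T) of vectors of R^k is a function
   v : 'I_T -> 'cV[R]_k ; the index i : 'I_T stands for time i + 1. *)

Section AffineSystem.
Context {R : realType} {n m p : nat}.
Variables (A : 'M[R]_n) (B : 'M[R]_(n, m)) (C : 'M[R]_(p, n))
          (D : 'M[R]_(p, m)) (E : 'cV[R]_n) (F : 'cV[R]_p).

Definition controllable : Prop :=
  \rank (\mxrow_(i < n) (A ^+ i *m B)) = n.

Definition iso_trajectory (T : nat) (u : 'I_T -> 'cV[R]_m)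
    (x : 'I_T -> 'cV[R]_n) (y : 'I_T -> 'cV[R]_p) : Prop :=
  (forall s t : 'I_T, t = s.+1 :> nat ->
     x t = A *m x s + B *m u s + E) /\
  (forall t : 'I_T, y t = C *m x t + D *m u t + F).

Definition io_trajectory (L : nat) (u : 'I_L -> 'cV[R]_m)
    (y : 'I_L -> 'cV[R]_p) : Prop :=
  exists x : 'I_L -> 'cV[R]_n, iso_trajectory u x y.

End AffineSystem.

Section Hankel.
Context {R : realType} {k : nat}.

(* mxvec is row-major, so listing the vectors as the rows of an L x k matrix
   makes this col(w(1), ..., w(L)). *)
Definition stack (L : nat) (w : 'I_L -> 'cV[R]_k) : 'cV[R]_(L * k) :=
  (mxvec (\matrix_(i < L) (w i)^T))^T.

Lemma window_lt (T L : nat) (j : 'I_(T.+1 - L)) (i : 'I_L) : (j + i < T)%N.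
Proof.
have := ltn_ord j; rewrite ltn_subRL addnC => jL.
by rewrite -ltnS (leq_trans _ jL) // !ltnS -addnS leq_add2l.
Qed.

Definition window (T : nat) (v : 'I_T -> 'cV[R]_k) (L : nat)
    (j : 'I_(T.+1 - L)) : 'I_L -> 'cV[R]_k :=
  fun i => v (Ordinal (window_lt j i)).

(* The number of columns T.+1 - L is T - L + 1 when L <= T; writing it this
   way leaves no columns, rather than a spurious one, when L > T. *)
Definition hankel (T L : nat) (v : 'I_T -> 'cV[R]_k) :
    'M[R]_(L * k, T.+1 - L) :=
  \matrix_(r, j) stack (window v j) r 0.

Definition restrict (T N : nat) (leNT : (N <= T)%N) (v : 'I_T -> 'cV[R]_k) :
    'I_N -> 'cV[R]_k :=
  fun j => v (widen_ord leNT j).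

Lemma initial_le (T L : nat) : (0 < L)%N -> (T.+1 - L <= T)%N.
Proof. by case: L => // L _; rewrite subSS leq_subr. Qed.

(* H_1 (v restricted to [1, T - L + 1]); the cast only identifies the number
   of columns (T - L + 1).+1 - 1 with T - L + 1. *)
Definition hankel1_initial (T L : nat) (L_gt0 : (0 < L)%N)
    (v : 'I_T -> 'cV[R]_k) : 'M[R]_(1 * k, T.+1 - L) :=
  castmx (erefl _, subn1 (T.+1 - L).+1)
         (hankel 1 (restrict (initial_le T L_gt0) v)).

(* Persistency of excitation for the class of affine systems. *)
Definition persistently_exciting (T K : nat) (u : 'I_T -> 'cV[R]_k) : Prop :=
  [/\ (0 < K)%N, (K <= T)%N &
      \rank (col_mx (hankel K u) (const_mx 1 : 'rV[R]_(T.+1 - K)))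
        = (k * K + 1)%N].

End Hankel.

(* Main.v *)
Require Import Defs.
From HB Require Import structures.
From mathcomp Require Import all_boot all_order all_algebra.
From mathcomp Require Import reals zify.

Set Implicit Arguments.
Unset Strict Implicit.
Unset Printing Implicit Defensive.

Import Order.TTheory GRing.Theory Num.Theory.
Local Open Scope ring_scope.

(* A row annihilating the matrix of (i) is a relation
     xi x(t) + sum_i eta_i u(t+i) + c = 0.
   Writing the k-fold shifts of this relation, k <= n, in terms of x(t) and the
   inputs, and combining them with the coefficients of the characteristic
   polynomial of A, Cayley-Hamilton eliminates the state. Persistency of
   excitation then kills the coefficients of the resulting relation on
   u(t), ..., u(t+n+L-1). As the characteristic polynomial is monic, these
   coefficients depend triangularly on eta_(L-1), ..., eta_0, xi B, xi A B, ...,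
   xi A^(n-1) B, so all of these vanish, and xi = 0 by controllability.
   For (ii), by (i) some affine combination of the data windows has the inputs
   and the initial state of the given trajectory, hence also its outputs. *)

(** * Sequences indexed by naturals, and products with Hankel matrices *)

(** Extension by zero lets time indices be shifted without carrying bounds. *)
Definition ext0 (V : zmodType) (N : nat) (v : 'I_N -> V) (t : nat) : V :=
  if insub t is Some i then v i else 0.

Lemma ext0E (V : zmodType) (N : nat) (v : 'I_N -> V) (i : 'I_N) :
  ext0 v i = v i.
Proof. by rewrite /ext0 valK. Qed.

Lemma ext0_ge (V : zmodType) (N : nat) (v : 'I_N -> V) (t : nat) :
  (N <= t)%N -> ext0 v t = 0.
Proof. by move=> leNt; rewrite /ext0 insubF // ltnNge leNt. Qed.

Lemma eq_stack (R : realType) (k L : nat) (v w : 'I_L -> 'cV[R]_k) :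
  v =1 w -> stack v = stack w.
Proof.
move=> eqvw; congr (mxvec _)^T.
by apply/matrixP => i l; rewrite !mxE eqvw.
Qed.

Lemma stack_inj (R : realType) (k L : nat) (v w : 'I_L -> 'cV[R]_k) :
  stack v = stack w -> v =1 w.
Proof.
move=> /trmx_inj /(can_inj mxvecK) /matrixP eqvw i.
by apply/matrixP => l b; have := eqvw i l; rewrite !mxE ord1.
Qed.

(** As [stack] is row-major, the block of [w] facing [v i] is row [i] of [vec_mx w]; a left kernel
    vector thus becomes a relation between terms of a sequence. *)
Lemma row_mul_stack (R : realType) (k L : nat) (w : 'rV[R]_(L * k))
    (v : 'I_L -> 'cV[R]_k) :
  w *m stack v = \sum_(i < L) row i (vec_mx w) *m v i.
Proof.
rewrite -[in LHS](vec_mxK w); move: (vec_mx w) => W.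
apply/matrixP=> a b; rewrite !ord1 mxE summxE.
rewrite (reindex _ (curry_mxvec_bij _ _)) /=.
rewrite (eq_bigr (fun i => \sum_j W i j * v i j 0)).
  by rewrite pair_bigA /=; apply: eq_bigr => -[i j] _; rewrite /stack mxE !mxvecE !mxE.
by move=> i _; rewrite mxE; apply: eq_bigr => j _; rewrite mxE.
Qed.

Lemma row_mul_hankel (R : realType) (k T L : nat) (w : 'rV[R]_(L * k))
    (v : 'I_T -> 'cV[R]_k) (j : 'I_(T.+1 - L)) :
  (w *m hankel L v) 0 j
    = (\sum_(i < L) row i (vec_mx w) *m ext0 v (j + i)) 0 0.
Proof.
transitivity ((w *m stack (window v j)) 0 0).
  by rewrite !mxE; apply: eq_bigr => r _; rewrite mxE.
rewrite row_mul_stack; congr ((_ : 'M__) 0 0); apply: eq_bigr => i _.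
by rewrite /window -ext0E.
Qed.

Lemma hankel1_initialE (R : realType) (k T L : nat) (L_gt0 : (0 < L)%N)
    (v : 'I_T -> 'cV[R]_k) (r : 'I_(1 * k)) (j : 'I_(T.+1 - L)) :
  hankel1_initial L_gt0 v r j = stack (fun _ : 'I_1 => ext0 v j) r 0.
Proof.
rewrite castmxE mxE cast_ord_id; congr ((_ : 'M__) r 0).
apply: eq_stack => i; rewrite /window /restrict -[v _]ext0E /=.
by rewrite ord1 addn0.
Qed.

Lemma row_mul_hankel1_initial (R : realType) (k T L : nat) (L_gt0 : (0 < L)%N)
    (w : 'rV[R]_(1 * k)) (v : 'I_T -> 'cV[R]_k) (j : 'I_(T.+1 - L)) :
  (w *m hankel1_initial L_gt0 v) 0 j = (row 0 (vec_mx w) *m ext0 v j) 0 0.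
Proof.
transitivity ((w *m stack (fun _ : 'I_1 => ext0 v j)) 0 0); last first.
  by rewrite row_mul_stack big_ord1.
rewrite !mxE.
by apply: eq_bigr => r _; rewrite hankel1_initialE.
Qed.

Lemma hankel_mul (R : realType) (k T L : nat) (v : 'I_T -> 'cV[R]_k)
    (g : 'cV[R]_(T.+1 - L)) :
  hankel L v *m g
    = stack (fun i : 'I_L => \sum_j g j 0 *: ext0 v (j + i)).
Proof.
apply/matrixP => r b; rewrite ord1 {b} mxE.
case/mxvec_indexP: r => i l.
rewrite /stack mxE mxvecE !mxE summxE; apply: eq_bigr => j _.
by rewrite mxE /stack mxE mxvecE !mxE mulrC /window -[v _]ext0E.
Qed.

Lemma hankel1_initial_mul (R : realType) (k T L : nat) (L_gt0 : (0 < L)%N)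
    (v : 'I_T -> 'cV[R]_k) (g : 'cV[R]_(T.+1 - L)) :
  hankel1_initial L_gt0 v *m g
    = stack (fun _ : 'I_1 => \sum_j g j 0 *: ext0 v j).
Proof.
apply/matrixP => r b; rewrite ord1 {b} mxE.
case/mxvec_indexP: r => i l.
rewrite /stack mxE mxvecE !mxE summxE; apply: eq_bigr => j _.
by rewrite hankel1_initialE /stack mxE mxvecE !mxE mulrC.
Qed.

(** * Cayley-Hamilton and triangular elimination *)

Lemma char_poly_sum (R : comNzRingType) (n : nat) (A : 'M[R]_n) :
  \sum_(k < n.+1) (char_poly A)`_k *: A ^+ k = 0.
Proof.
(* [horner_mx] needs a positive dimension; in dimension 0 there are no entries to compare. *)
case: n A => [|n] A; first by apply/matrixP => - [].
transitivity (horner_mx A (\sum_(k < n.+2) (char_poly A)`_k *: 'X^k)).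
  rewrite linear_sum /=; apply: eq_bigr => k _.
  by rewrite linearZ /= rmorphXn /= horner_mx_X.
by rewrite -(size_char_poly A) -poly_def coefK Cayley_Hamilton.
Qed.

(** The term [k = n] of the [i]-th relation is [z i] itself and the others involve only later
    indices, so descending induction from [N] applies. *)
Lemma monic_recurrence_eq0 (R : nzRingType) (V : lmodType R) (n N : nat)
    (a : nat -> R) (z : nat -> V) :
  a n = 1 -> (forall s, (N <= s)%N -> z s = 0) ->
  (forall i, (i < N)%N -> \sum_(k < n.+1) a k *: z (i + (n - k))%N = 0) ->
  forall i, z i = 0.
Proof.
move=> an z_ge rec.
suff z0 d i : (N - i <= d)%N -> z i = 0 by move=> i; exact: z0 (leqnn _).
elim: d i => [|d IHd] i led.
  by apply: z_ge; rewrite -subn_eq0 -leqn0.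
have [/z_ge //|ltiN] := leqP N i.
have := rec i ltiN; rewrite big_ord_recr /= subnn addn0 an scale1r.
rewrite big1 ?add0r // => k _; rewrite IHd ?scaler0 //.
rewrite subnDA leq_subLR (leq_trans led) // -add1n leq_add2r.
by rewrite subn_gt0.
Qed.

(** * Affine relations between one state and a window of inputs *)

Section Annihilator.
Context {R : realType} {n m : nat}.
Variables (A : 'M[R]_n) (B : 'M[R]_(n, m)) (E : 'cV[R]_n) (T L : nat).
Variables (u : nat -> 'cV[R]_m) (x : nat -> 'cV[R]_n).
Hypothesis dyn : forall t, (t.+1 < T)%N -> x t.+1 = A *m x t + B *m u t + E.
Variables (xi : 'rV[R]_n) (eta : nat -> 'rV[R]_m) (c : 'M[R]_1).
Hypothesis eta_ge : forall i, (L <= i)%N -> eta i = 0.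
Hypothesis rel : forall j, (j + L <= T)%N ->
  xi *m x j + \sum_(i < L) eta i *m u (j + i)%N + c = 0.

(* Markov parameters of [xi] in reverse order, followed by [eta]: shifting the
   relation [k] times and eliminating the state turns the coefficients of the
   inputs into the window of [markov] starting at [n - k]. *)
Definition markov (s : nat) : 'rV[R]_m :=
  if (s < n)%N then xi *m A ^+ (n - s.+1) *m B else eta (s - n).

Lemma markov_ge s : (n + L <= s)%N -> markov s = 0.
Proof.
move=> les; rewrite /markov ltnNge (leq_trans (leq_addr L n) les) /=.
by apply: eta_ge; rewrite leq_subRL // (leq_trans (leq_addr L n) les).
Qed.

(** Induction on [k]: take the relation at [j.+1] and substitute the dynamics for [x j.+1]. The new
    input term [xi *m A ^+ k *m B *m u j] is the entry by which the window of [markov] grows on the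
    left, and [xi *m A ^+ k *m E] joins the constant. *)
Lemma shifted_relation k j : (0 < L)%N -> (k <= n)%N -> (j + k + L <= T)%N ->
  xi *m A ^+ k *m x j + \sum_(i < n + L) markov (i + (n - k)) *m u (j + i)%N
    + (c + \sum_(l < k) xi *m A ^+ l *m E) = 0.
Proof.
move=> L_gt0; elim: k j => [|k IHk] j lekn lejT.
  rewrite big_ord0 addr0 subn0 expr0 mulmx1 -[RHS](rel (j := j)); last first.
    by rewrite addn0 in lejT.
  congr (_ + _ + _).
  have markovD i : markov (i + n) = eta i.
    by rewrite /markov ltnNge leq_addl addnK.
  rewrite (eq_bigr (fun i : 'I_(n + L) => eta i *m u (j + i)%N)); last first.
    by move=> i _; rewrite markovD.
  (* The sum over [L] terms is padded to [n + L] terms, [eta] being zero from [L] on. *)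
  rewrite (big_ord_widen _ (fun i => eta i *m u (j + i)%N) (leq_addl n L)).
  rewrite [RHS]big_mkcond; apply: eq_bigr => i _.
  by case: ltnP => // /eta_ge ->; rewrite mul0mx.
have := IHk j.+1 (ltnW lekn).
(* Positivity of [L] gives [j.+1 < T], so the dynamics hold at [j]. *)
rewrite addSn -addnS => /(_ lejT); rewrite dyn; last by lia.
rewrite !mulmxDr [\sum_(l < k.+1) _]big_ord_recr /=.
have nk : (n - k = (n - k.+1).+1)%N by rewrite -subSn // subSS.
set S1 := \sum_(i < n + L) _; set S2 := \sum_(i < n + L) _.
have -> : S2 = xi *m A ^+ k *m B *m u j + S1.
  rewrite /S1 /S2.
  (* Adding the zero term [f (n + L)] allows the first term to be split off while [n + L] terms
     remain. *)
  pose f i := markov (i + (n - k.+1)) *m u (j + i)%N.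
  have fNL : f (n + L)%N = 0 by rewrite /f markov_ge ?mul0mx // leq_addr.
  have <- : \sum_(i < (n + L).+1) f i = \sum_(i < n + L) f i.
    by rewrite big_ord_recr /= fNL addr0.
  rewrite big_ord_recl.
  congr (_ + _).
    rewrite /f add0n addn0 /markov -nk leq_subr.
    by rewrite subKn // ltnW.
  by apply: eq_bigr => i _; congr (markov _ *m u _); rewrite lift0; lia.
have -> : A ^+ k.+1 = A ^+ k *m A by rewrite exprSr.
move=> rel_k; rewrite -[RHS]rel_k !mulmxA -!addrA; do 2!congr (_ + _).
by rewrite [RHS]addrC -!addrA.
Qed.

Lemma annihilator_eq0 : controllable A B -> (0 < L)%N -> (n + L <= T)%N ->
  (forall (w : nat -> 'rV[R]_m) (d : 'M[R]_1),
     (forall j, (j + (n + L) <= T)%N ->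
        \sum_(i < n + L) w i *m u (j + i)%N + d = 0) ->
     forall i, (i < n + L)%N -> w i = 0) ->
  [/\ xi = 0, forall i, eta i = 0 & c = 0].
Proof.
move=> ctrlAB L_gt0 leT PE.
pose a := fun k => (char_poly A)`_k.
have an : a n = 1.
  by have /monicP := char_poly_monic A; rewrite lead_coefE size_char_poly.
have markov0 : forall i, markov i = 0.
  apply: (monic_recurrence_eq0 an markov_ge).
  (* The input coefficients are the combination of [markov] windows weighted by the characteristic
     polynomial; the constants are combined alike. *)
  apply: (PE _ (\sum_(k < n.+1) a k *: (c + \sum_(l < k) xi *m A ^+ l *m E))).
  move=> j lej.
  transitivity (\sum_(k < n.+1) a k *: (xi *m A ^+ k *m x j
      + \sum_(i < n + L) markov (i + (n - k)) *m u (j + i)%N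
      + (c + \sum_(l < k) xi *m A ^+ l *m E))).
    under [RHS]eq_bigr do rewrite scalerDr.
    rewrite big_split /=; congr (_ + _).
    under [RHS]eq_bigr do rewrite scalerDr.
    rewrite big_split /= -[LHS]add0r; congr (_ + _).
      (* The state terms add up to [xi] times the characteristic polynomial at [A] times [x j]. *)
      under eq_bigr do rewrite -!mulmxA scalemxAr scalemxAl.
      by rewrite -mulmx_sumr -mulmx_suml char_poly_sum mul0mx mulmx0.
    under [RHS]eq_bigr do rewrite scaler_sumr.
    rewrite exchange_big /=; apply: eq_bigr => i _.
    by rewrite mulmx_suml; apply: eq_bigr => k _; rewrite scalemxAl.
  rewrite big1 // => k _; have lekn : (k <= n)%N by rewrite -ltnS.
  by rewrite shifted_relation ?scaler0 //; lia.
have eta0 i : eta i = 0.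
  by have := markov0 (i + n)%N; rewrite /markov ltnNge leq_addl addnK.
have xi0 : xi = 0.
  have free : row_free (\mxrow_(i < n) (A ^+ i *m B)) by apply/eqP.
  apply: (row_free_inj free); rewrite mul0mx mul_mxrow -mxrow0.
  (* This entry of [markov] is [xi *m A ^+ i *m B], a block of [xi] times the controllability
     matrix. *)
  apply: eq_mxrow => i; have := markov0 (n - i.+1)%N.
  rewrite /markov -subSn // subSS leq_subr subKn; last exact: ltnW.
  by rewrite mulmxA.
split=> //; have := rel (j := 0); rewrite (leq_trans (leq_addl n L)) //.
rewrite xi0 mul0mx add0r big1 ?add0r; first by apply.
by move=> i _; rewrite eta0 mul0mx.
Qed.

End Annihilator.

(** * Independence of the rows of the data matrices *)

(** The rank [k * K + 1] is the number of rows, so the left kernel is trivial; the relation at time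
    [j] is column [j] of the product with the row of coefficients. *)
Lemma persistently_exciting_nat (R : realType) (k T K : nat)
    (u : 'I_T -> 'cV[R]_k) (w : nat -> 'rV[R]_k) (d : 'M[R]_1) :
  persistently_exciting K u ->
  (forall j, (j + K <= T)%N ->
     \sum_(i < K) w i *m ext0 u (j + i)%N + d = 0) ->
  forall i, (i < K)%N -> w i = 0.
Proof.
move=> [K_gt0 leKT rkK] wd.
have free : row_free (col_mx (hankel K u) (const_mx 1 : 'rV[R]_(T.+1 - K))).
  by apply/eqP; rewrite rkK mulnC.
pose W : 'M[R]_(K, k) := \matrix_(i < K) w i.
have /(row_free_inj free) : row_mx (mxvec W) d *m
    col_mx (hankel K u) (const_mx 1 : 'rV[R]_(T.+1 - K)) =
  0 *m col_mx (hankel K u) (const_mx 1 : 'rV[R]_(T.+1 - K)).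
  rewrite mul0mx mul_row_col; apply/matrixP => a j; rewrite ord1 mxE.
  rewrite row_mul_hankel mxvecK [X in _ + X]mxE big_ord1 [const_mx _ _ _]mxE mulr1.
  have lej : (j + K <= T)%N by have := ltn_ord j; rewrite ltn_subRL addnC ltnS.
  have /matrixP/(_ 0 0) := wd j lej; rewrite !mxE => <-; congr (_ + _).
  by rewrite !summxE; apply: eq_bigr => i _; rewrite rowK.
rewrite -row_mx0 => /eq_row_mx[W0 _] i ltiK.
have := congr1 (row (Ordinal ltiK)) (can_inj mxvecK (etrans W0 (esym (linear0 _)))).
by rewrite rowK row0.
Qed.

Lemma hankel_rows_free (R : realType) (n m p : nat)
    (A : 'M[R]_n) (B : 'M[R]_(n, m)) (C : 'M[R]_(p, n)) (D : 'M[R]_(p, m))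
    (E : 'cV[R]_n) (F : 'cV[R]_p) (T L : nat)
    (u : 'I_T -> 'cV[R]_m) (x : 'I_T -> 'cV[R]_n) (y : 'I_T -> 'cV[R]_p)
    (L_gt0 : (0 < L)%N) :
  controllable A B -> iso_trajectory A B C D E F u x y ->
  persistently_exciting (n + L) u ->
  row_free (col_mx (hankel1_initial L_gt0 x)
    (col_mx (hankel L u) (const_mx 1 : 'rV[R]_(T.+1 - L)))).
Proof.
move=> ctrlAB [dyn _] PE; have [_ leT _] := PE.
apply: inj_row_free => w; rewrite -[w]hsubmxK -[rsubmx w]hsubmxK.
move: (lsubmx w) (lsubmx (rsubmx w)) (rsubmx (rsubmx w)) => w1 w2 c.
rewrite !mul_row_col => w_rel.
(* The zero extension supplies the vanishing of [eta] from [L] on. *)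
pose eta := ext0 (fun i => row i (vec_mx w2)).
have [|||xi0 eta0 c0] := @annihilator_eq0 R n m A B E T L (ext0 u) (ext0 x) _
    (row 0 (vec_mx w1)) eta c (ext0_ge _) _ ctrlAB L_gt0 leT.
- move=> t ltT.
  have := dyn (Ordinal (ltnW ltT)) (Ordinal ltT) erefl.
  by rewrite -!ext0E.
- move=> j lej; apply/matrixP => a b; rewrite !ord1 {a b}.
  have ltj : (j < T.+1 - L)%N by rewrite ltn_subRL addnC ltnS.
  have /matrixP/(_ 0 (Ordinal ltj)) := w_rel; rewrite ![((_ + _)%R : 'M__) _ _]mxE.
  rewrite row_mul_hankel1_initial row_mul_hankel [(c *m _) _ _]mxE big_ord1.
  rewrite [const_mx _ _ _]mxE mulr1 addrA => w_j.
  transitivity ((0 : 'rV[R]_(T.+1 - L)) 0 (Ordinal ltj)); last by rewrite !mxE.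
  rewrite -w_j !mxE; do 2!congr (_ + _).
  congr ((_ : 'M__) 0 0); apply: eq_bigr => i _.
  by rewrite /eta ext0E.
- by move=> w' d rel; exact: persistently_exciting_nat PE rel.
have -> : w1 = 0.
  rewrite -[w1]vec_mxK -[RHS](linear0 (@mxvec R 1 n)); congr mxvec.
  by apply/row_matrixP => i; rewrite ord1 xi0 row0.
have -> : w2 = 0.
  rewrite -[w2]vec_mxK -[RHS](linear0 (@mxvec R L m)); congr mxvec.
  by apply/row_matrixP => i; rewrite row0 -(eta0 i) /eta ext0E.
by rewrite c0 !row_mx0.
Qed.

(** * Affine combinations of data windows *)

(** Weights of sum 1 reproduce the offsets [E] and [F], so the combined windows obey the system
    equations; induction on time propagates the agreement of initial states. *)
Lemma affine_comb_trajectory (R : realType) (n m p : nat)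
    (A : 'M[R]_n) (B : 'M[R]_(n, m)) (C : 'M[R]_(p, n)) (D : 'M[R]_(p, m))
    (E : 'cV[R]_n) (F : 'cV[R]_p) (T L : nat)
    (ud : 'I_T -> 'cV[R]_m) (xd : 'I_T -> 'cV[R]_n) (yd : 'I_T -> 'cV[R]_p)
    (u : 'I_L -> 'cV[R]_m) (x : 'I_L -> 'cV[R]_n) (y : 'I_L -> 'cV[R]_p)
    (g : 'I_(T.+1 - L) -> R) :
  iso_trajectory A B C D E F ud xd yd -> iso_trajectory A B C D E F u x y ->
  \sum_j g j = 1 ->
  (forall i : 'I_L, u i = \sum_j g j *: ext0 ud (j + i)) ->
  (forall i : 'I_L, i = 0 :> nat -> x i = \sum_j g j *: ext0 xd (j + i)) ->
  forall i : 'I_L, y i = \sum_j g j *: ext0 yd (j + i).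
Proof.
move=> [dynd outd] [dyn out] g1 ug x0g.
have comb k1 k2 (M : 'M[R]_(k1, k2)) (v : 'I_(T.+1 - L) -> 'cV[R]_k2) :
    M *m (\sum_j g j *: v j) = \sum_j g j *: (M *m v j).
  by rewrite mulmx_sumr; apply: eq_bigr => j _; rewrite scalemxAr.
have combc k (v : 'cV[R]_k) : v = \sum_j g j *: v.
  by rewrite -scaler_suml g1 scale1r.
have xg t (ltL : (t < L)%N) :
    x (Ordinal ltL) = \sum_j g j *: ext0 xd (j + t).
  elim: t ltL => [|t IHt] ltL; first exact: x0g.
  rewrite (dyn (Ordinal (ltnW ltL)) (Ordinal ltL) erefl) ug IHt !comb.
  rewrite [E in LHS]combc -!big_split; apply: eq_bigr => j _ /=.
  rewrite -!scalerDr; congr (_ *: _).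
  (* Every window stays inside the data, so [ext0] never takes its default value here. *)
  have jt : (j + t.+1 < T)%N := window_lt j (Ordinal ltL).
  have jt' : (j + t < T)%N by rewrite (ltn_trans _ jt) // addnS.
  have := dynd (Ordinal jt') (Ordinal jt) (addnS _ _).
  by rewrite -!ext0E.
move=> i; rewrite out ug; case: i => t ltL /=; rewrite xg !comb.
rewrite [F in LHS]combc -!big_split; apply: eq_bigr => j _ /=.
rewrite -!scalerDr; congr (_ *: _).
by have := outd (Ordinal (window_lt j (Ordinal ltL))); rewrite -!ext0E.
Qed.

Theorem theorem8 (R : realType) (n m p : nat)
    (A : 'M[R]_n) (B : 'M[R]_(n, m)) (C : 'M[R]_(p, n)) (D : 'M[R]_(p, m))
    (E : 'cV[R]_n) (F : 'cV[R]_p)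
    (ctrlAB : controllable A B)
    (T : nat) (ud : 'I_T -> 'cV[R]_m) (xd : 'I_T -> 'cV[R]_n)
    (yd : 'I_T -> 'cV[R]_p)
    (trajd : iso_trajectory A B C D E F ud xd yd)
    (L : nat) (L_gt0 : (0 < L)%N)
    (PEud : persistently_exciting (n + L) ud) :
  \rank (col_mx (hankel1_initial L_gt0 xd)
                (col_mx (hankel L ud) (const_mx 1 : 'rV[R]_(T.+1 - L))))
    = (m * L + n + 1)%N
  /\
  (forall (u : 'I_L -> 'cV[R]_m) (y : 'I_L -> 'cV[R]_p),
     io_trajectory A B C D E F u y ->
     exists g : 'cV[R]_(T.+1 - L),
       (const_mx 1 : 'rV[R]_(T.+1 - L)) *m g = 1%:M /\
       col_mx (stack u) (stack y)
         = col_mx (hankel L ud) (hankel L yd) *m g).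
Proof.
have free := hankel_rows_free L_gt0 ctrlAB trajd PEud.
split; first by rewrite (eqP free); lia.
move=> u y [x traj].
set M := col_mx _ _ in free.
pose x0 : 'cV[R]_(1 * n) := stack (fun _ : 'I_1 => x (Ordinal L_gt0)).
(* By full row rank [pinvmx M] is a right inverse of [M], so initial state, inputs and sum of
   weights can be prescribed at once. *)
pose g := pinvmx M *m col_mx x0 (col_mx (stack u) 1%:M).
have : M *m g = col_mx x0 (col_mx (stack u) 1%:M).
  by rewrite mulmxA mulmxVp // mul1mx.
rewrite /M !mul_col_mx => /eq_col_mx[x0g /eq_col_mx[ug g1]].
exists g; split=> //; rewrite mul_col_mx ug; congr col_mx.
rewrite hankel_mul; apply: eq_stack.
apply: (affine_comb_trajectory trajd traj).
- have /matrixP/(_ 0 0) := g1; rewrite [1%:M _ _]mxE eqxx mulr1n mxE => <-.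
  by apply: eq_bigr => j _; rewrite [const_mx _ _ _]mxE mul1r.
- by apply: stack_inj; rewrite -ug hankel_mul.
move=> i i0; have -> : i = Ordinal L_gt0 by apply: val_inj.
rewrite (stack_inj (etrans (esym x0g) (hankel1_initial_mul L_gt0 xd g)) 0).
by apply: eq_bigr => j _; rewrite addn0.
Qed.
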